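(* Let $P$ be one of the following posets (the ''root posets of coincidental type''): (i) $\Phi^+(A_n)$ for some $n\geq 1$; (ii) $\Phi^+(B_n)$ for some $n\geq 1$; (iii) $\Phi^+(H_3)$; (iv) $\Phi^+(I_2(m))$ for some $m\geq 2$. Then the distributive lattice $J(P)$ is toggle CDE (tCDE).
   Context: All posets are finite. For a poset $P$, $J(P)$ is the set of order ideals (down-closed subsets) of $P$. For $I\in J(P)$, $\mathrm{ddeg}(I)$ is the number of elements of $J(P)$ covered by $I$ under inclusion, equivalently the number of maximal elements of $I$. For $p\in P$, the toggle $\tau_p\colon J(P)\to J(P)$ is $\tau_p(I)=I\cup\{p\}$ if $p\notin I$ and $I\cup\{p\}\in J(P)$; $\tau_p(I)=I\setminus\{p\}$ if $p\in I$ and $I\setminus\{p\}\in J(P)$; and $\tau_p(I)=I$ otherwise. Define $\mathcal{T}_{p^+}(I)=1$ if $I\subsetneq\tau_p(I)$ and $0$ otherwise; $\mathcal{T}_{p^-}(I)=1$ if $\tau_p(I)\subsetneq I$ and $0$ otherwise; and $\mathcal{T}_p=\mathcal{T}_{p^+}-\mathcal{T}_{p^-}$. A probability distribution $\mu$ on $J(P)$ is toggle-symmetric if $\mathbb{E}_\mu[\mathcal{T}_p]=0$ for every $p\in P$. $J(P)$ is tCDE if $\mathbb{E}_\mu[\mathrm{ddeg}]$ equals the average of $\mathrm{ddeg}$ over $J(P)$ under the uniform distribution, for every toggle-symmetric distribution $\mu$ on $J(P)$. The posets: $\Phi^+(A_n)$ has elements $(i,j)\in\mathbb{Z}^2$ with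 $1\leq i\leq j\leq n$, and $(i,j)\leq(i',j')$ iff $i'\leq i$ and $j\leq j'$. $\Phi^+(B_n)$ has elements $(i,j)\in\mathbb{Z}^2$ with $1\leq i\leq n$ and $i\leq j\leq 2n-i$, and $(i,j)\leq(i',j')$ iff $i'\leq i$ and $j'\leq j$. $\Phi^+(H_3)$ has $15$ elements $x_1,\ldots,x_{15}$, with partial order the transitive closure of the following cover relations: $x_4$ covers $x_1,x_2$; $x_5$ covers $x_2,x_3$; $x_6$ covers $x_4,x_5$; $x_7$ covers $x_5$; $x_8$ covers $x_6,x_7$; $x_9$ covers $x_7$; $x_{10}$ covers $x_8$; $x_{11}$ covers $x_8,x_9$; $x_{12}$ covers $x_{10},x_{11}$; $x_{13}$ covers $x_{12}$; $x_{14}$ covers $x_{13}$; $x_{15}$ covers $x_{14}$. $\Phi^+(I_2(m))$ has $m$ elements $a,b,c_1,\ldots,c_{m-2}$, where $a,b$ are incomparable, $c_1<c_2<\cdots<c_{m-2}$ is a chain, and (if $m\geq 3$) $a<c_1$ and $b<c_1$. *)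

(* Defs.v *)
From HB Require Import structures.
From mathcomp Require Import all_boot all_order all_algebra.
From mathcomp Require Import reals.

Set Implicit Arguments.
Unset Strict Implicit.
Unset Printing Implicit Defensive.

Import Order.TTheory GRing.Theory Num.Theory.

Section Ideals.
Context {d : Order.disp_t} {P : finPOrderType d}.

Definition is_ideal (I : {set P}) : bool :=
  [forall x in I, forall y, (y <= x)%O ==> (y \in I)].

Record ideal := Ideal { ideal_set :> {set P}; ideal_setP : is_ideal ideal_set }.

HB.instance Definition _ := [isSub for ideal_set].
HB.instance Definition _ := [Finite of ideal by <:].

Definition ideal_covered (K I : ideal) : bool :=
  (K \proper I) && ~~ [exists L : ideal, (K \proper L) && (L \proper I)].

Definition ddeg (I : ideal) : nat := #|[set K : ideal | ideal_covered K I]|.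

(* insubd I A is the ideal A when A is an ideal, and I otherwise *)
Definition toggle (p : P) (I : ideal) : ideal :=
  if p \in I then insubd I (I :\ p) else insubd I (p |: I).

End Ideals.

Arguments ideal {d} P.

Notation "''J' ( P )" := (ideal P) (at level 8, format "''J' ( P )") : type_scope.

Local Open Scope ring_scope.

Section ToggleSymmetry.
Context {R : realType} {d : Order.disp_t} {P : finPOrderType d}.

Definition toggle_plus (p : P) (I : 'J(P)) : R := (I \proper toggle p I)%:R.
Definition toggle_minus (p : P) (I : 'J(P)) : R := (toggle p I \proper I)%:R.
Definition toggleability (p : P) (I : 'J(P)) : R :=
  toggle_plus p I - toggle_minus p I.

Definition is_distribution (mu : 'J(P) -> R) : Prop :=
  (forall I, 0 <= mu I) /\ \sum_I mu I = 1.

Definition expectation (mu f : 'J(P) -> R) : R := \sum_I mu I * f I.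

Definition uniform (I : 'J(P)) : R := #|{: 'J(P)}|%:R^-1.

Definition toggle_symmetric (mu : 'J(P) -> R) : Prop :=
  forall p : P, expectation mu (toggleability p) = 0.

End ToggleSymmetry.

Definition tCDE (R : realType) (d : Order.disp_t) (P : finPOrderType d) : Prop :=
  forall mu : 'J(P) -> R, is_distribution mu -> toggle_symmetric mu ->
    expectation mu (fun I => (ddeg I)%:R) =
    expectation uniform (fun I : 'J(P) => (ddeg I)%:R).

Local Close Scope ring_scope.

Fact root_display : Order.disp_t. Proof. exact: (Order.Disp tt tt). Qed.

Section TypeA.
Variable n : nat.

(* the ordinal bounds leave room for the 1-based coordinates *)
Definition PhiA := {x : 'I_n.+1 * 'I_n.+1 | 1 <= x.1 <= x.2}.

HB.instance Definition _ := Finite.on PhiA.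

Definition leA (x y : PhiA) : bool :=
  ((val y).1 <= (val x).1) && ((val x).2 <= (val y).2).

Fact leA_refl : reflexive leA.
Proof. by move=> x; rewrite /leA !leqnn. Qed.

Fact leA_anti : antisymmetric leA.
Proof.
move=> [[a b] h] [[a' b'] h']; rewrite /leA /= => /andP[/andP[h1 h2] /andP[h3 h4]].
by apply/val_inj; congr pair; apply/val_inj/eqP; rewrite eqn_leq ?h1 ?h2 ?h3 ?h4.
Qed.

Fact leA_trans : transitive leA.
Proof.
move=> y x z /andP[h1 h2] /andP[h3 h4].
by rewrite /leA (leq_trans h3 h1) (leq_trans h2 h4).
Qed.

HB.instance Definition _ :=
  Order.Le_isPOrder.Build root_display PhiA leA_refl leA_anti leA_trans.

End TypeA.

Section TypeB.
Variable n : nat.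

Definition PhiB :=
  {x : 'I_n.+1 * 'I_(2 * n).+1 | (1 <= x.1) && (x.1 <= x.2 <= 2 * n - x.1)}.

HB.instance Definition _ := Finite.on PhiB.

Definition leB (x y : PhiB) : bool :=
  ((val y).1 <= (val x).1) && ((val y).2 <= (val x).2).

Fact leB_refl : reflexive leB.
Proof. by move=> x; rewrite /leB !leqnn. Qed.

Fact leB_anti : antisymmetric leB.
Proof.
move=> [[a b] h] [[a' b'] h']; rewrite /leB /= => /andP[/andP[h1 h2] /andP[h3 h4]].
by apply/val_inj; congr pair; apply/val_inj/eqP; rewrite eqn_leq ?h1 ?h2 ?h3 ?h4.
Qed.

Fact leB_trans : transitive leB.
Proof.
move=> y x z /andP[h1 h2] /andP[h3 h4].
by rewrite /leB (leq_trans h3 h1) (leq_trans h4 h2).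
Qed.

HB.instance Definition _ :=
  Order.Le_isPOrder.Build root_display PhiB leB_refl leB_anti leB_trans.

End TypeB.

(* the ordinal i : 'I_15 stands for x_(i+1) *)
Definition PhiH3 := 'I_15.

HB.instance Definition _ := Finite.on PhiH3.

(* (a, b) means that x_b covers x_a *)
Definition H3_cover_pairs : seq (nat * nat) :=
  [:: (1, 4); (2, 4); (2, 5); (3, 5); (4, 6); (5, 6); (5, 7); (6, 8); (7, 8);
      (7, 9); (8, 10); (8, 11); (9, 11); (10, 12); (11, 12); (12, 13);
      (13, 14); (14, 15)].

Definition H3_cover : rel PhiH3 :=
  fun x y => ((x : 'I_15).+1, (y : 'I_15).+1) \in H3_cover_pairs.

Definition leH3 : rel PhiH3 := connect H3_cover.

Fact leH3_refl : reflexive leH3.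
Proof. exact: connect0. Qed.

Fact leH3_leq (x y : PhiH3) : leH3 x y -> (x : 'I_15) <= (y : 'I_15).
Proof.
have cov (a b : PhiH3) : H3_cover a b -> (a : 'I_15) <= (b : 'I_15).
  rewrite /H3_cover => ab.
  have /allP/(_ _ ab) : all (fun u => u.1 <= u.2) H3_cover_pairs by [].
  by [].
move=> /connectP[s]; elim: s x => [|a s IH] x /=; first by move=> _ ->.
by move=> /andP[/cov xa /IH{}IH] /IH; apply: leq_trans.
Qed.

Fact leH3_anti : antisymmetric leH3.
Proof.
move=> x y /andP[/leH3_leq h1 /leH3_leq h2].
by apply/val_inj/eqP; rewrite eqn_leq h1 h2.
Qed.

Fact leH3_trans : transitive leH3.
Proof. exact: connect_trans. Qed.

HB.instance Definition _ :=
  Order.Le_isPOrder.Build root_display PhiH3 leH3_refl leH3_anti leH3_trans.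

Section TypeI2.
Variable m : nat.

(* a = inl false, b = inl true, c_(k+1) = inr k *)
Definition PhiI2 : Type := (bool + 'I_(m - 2))%type.

HB.instance Definition _ := Finite.on PhiI2.

Definition leI2 (x y : PhiI2) : bool :=
  match x, y with
  | inl u, inl v => u == v
  | inl _, inr _ => true
  | inr _, inl _ => false
  | inr k, inr l => k <= l
  end.

Fact leI2_refl : reflexive leI2.
Proof. by case=> u /=. Qed.

Fact leI2_anti : antisymmetric leI2.
Proof.
case=> u [] v //=; first by move=> /andP[/eqP ->].
by move=> uv; congr inr; apply/val_inj/eqP; rewrite eqn_leq.
Qed.

Fact leI2_trans : transitive leI2.
Proof.
case=> y [] x [] z //=; first by move=> /eqP -> /eqP ->.
exact: leq_trans.
Qed.

HB.instance Definition _ :=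
  Order.Le_isPOrder.Build root_display PhiI2 leI2_refl leI2_anti leI2_trans.

End TypeI2.

(* Main.v *)
Require Import Defs.
From mathcomp Require Import all_boot all_order all_algebra reals.
From mathcomp Require Import zify ring lra.

(* It suffices to write a * ddeg, with a nonzero, as a constant plus a linear
   combination of the toggleabilities T_p: these have expectation zero under any
   toggle-symmetric distribution, and the uniform one is toggle-symmetric because
   a toggle is an involution that negates T_p.

   An ideal of type A_n is determined by its first rows f(0) <= ... <= f(n + 1)
   in the successive columns, where f(j) <= j + 1 for j <= n. Column j contributes
   a removable element in row f(j) when f(j) < min(f(j + 1), j + 1), and an
   addable one in row f(j) - 1 when f(j - 1) < f(j). Weighted by j + 1 - i and
   i + 1 - j respectively, where i is the row, these contributions telescope, which
   gives 2 * ddeg = n + \sum_(i, j) (j - i - 1) * T_(i,j).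

   The poset of type B_n is the quotient of type A_(2n-1) by a reflection, and
   this identity descends to the quotient, except that the elements on the axis of
   the reflection get half the weight of the others. This is repaired by an
   identity for the axis, on which exactly one element can be toggled.

   Types H_3 and I_2(m) are direct computations. *)

Set Implicit Arguments.
Unset Strict Implicit.
Unset Printing Implicit Defensive.

Import Order.TTheory GRing.Theory Num.Theory.

(** * Toggles *)

Lemma exists_maximal {d : Order.disp_t} {P : finPOrderType d} (A : {set P}) x :
  x \in A -> exists2 p, p \in A & forall q, q \in A -> (p <= q)%O -> q = p.
Proof.
pose down (y : P) := [set z | (z <= y)%O].
move=> /(arg_maxnP (fun y => #|down y|))[p pA pmax].
exists p => // q qA pq; apply/eqP; rewrite eq_le pq andbT.
have down_sub : down p \subset down q.
  by apply/subsetP => z; rewrite !inE => /le_trans; apply.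
have /eqP/setP/(_ q) : down p == down q by rewrite eqEcard down_sub [_ <= _]pmax.
by rewrite !inE lexx.
Qed.

Section Toggles.
Context {d : Order.disp_t} {P : finPOrderType d}.
Implicit Types (p q : P) (I K : 'J(P)).

Definition removable p I : bool := (p \in I) && is_ideal (I :\ p).
Definition addable p I : bool := (p \notin I) && is_ideal (p |: I).

Lemma is_idealP (A : {set P}) :
  reflect (forall p q, p \in A -> (q <= p)%O -> q \in A) (is_ideal A).
Proof.
apply: (iffP forall_inP) => [A_down p q /A_down/forallP/(_ q)/implyP|A_down p pA].
  exact.
by apply/forallP => q; apply/implyP; apply: A_down.
Qed.

Lemma ideal_le I p q : p \in I -> (q <= p)%O -> q \in I.
Proof. exact/(is_idealP _ (ideal_setP I)). Qed.

Lemma removableP p I :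
  reflect (p \in I /\ forall q, q \in I -> (p <= q)%O -> q = p) (removable p I).
Proof.
apply: (iffP andP) => [[pI /is_idealP Ip_down]|[pI pmax]]; split=> //.
  move=> q qI pq; apply: contraTeq isT => qp.
  by have := Ip_down q p; rewrite !inE qp qI eqxx => /(_ isT pq).
apply/is_idealP => q r; rewrite !inE => /andP[qp qI] rq.
rewrite (ideal_le qI rq) andbT; apply: contra_neq qp => rp.
by apply: pmax => //; rewrite -rp.
Qed.

Lemma addableP p I :
  reflect (p \notin I /\ forall q, (q <= p)%O -> q != p -> q \in I) (addable p I).
Proof.
apply: (iffP andP) => [[pI /is_idealP Ip_down]|[pI pmin]]; split=> //.
  move=> q qp nqp; have := Ip_down p q; rewrite !inE eqxx => /(_ isT qp).
  by rewrite (negPf nqp).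
apply/is_idealP => q r; rewrite !inE => /orP[/eqP -> rp|qI rq].
  by have [//|nrp] := eqVneq r p; apply: pmin.
by rewrite (ideal_le qI rq) orbT.
Qed.

Lemma ideal_set_toggle p I :
  ideal_set (toggle p I) =
  if removable p I then I :\ p else if addable p I then p |: I else I.
Proof.
rewrite /toggle /removable /addable; case: (p \in I) => /=;
  by rewrite /insubd; case: insubP => [u -> ->|/negPf ->].
Qed.

Lemma toggle_proper p I : (toggle p I \proper I) = removable p I.
Proof.
rewrite ideal_set_toggle; case: ifP => [/andP[pI _]|_]; first exact: properD1.
case: ifP => [/andP[pI _]|_]; last by rewrite properxx.
by apply/negP => /proper_sub/subsetP/(_ p (setU11 _ _)); apply/negP.
Qed.

Lemma proper_toggle p I : (I \proper toggle p I) = addable p I.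
Proof.
rewrite ideal_set_toggle; case: ifP => [/andP[pI _]|_].
  rewrite /addable pI; apply/negP => /proper_sub/subsetP/(_ p pI).
  by rewrite setD11.
case: ifP => [/andP[pI _]|_]; last by rewrite properxx.
by rewrite properUr // sub1set.
Qed.

Lemma toggleK p : involutive (toggle p).
Proof.
move=> I; apply: val_inj => /=; rewrite ideal_set_toggle.
rewrite /removable /addable ideal_set_toggle.
case nr: (removable p I).
  by have /andP[pI _] := nr; rewrite setD11 /= setD1K // (ideal_setP I).
case na: (addable p I).
  by have /andP[pI _] := na; rewrite setU11 setU1K // (ideal_setP I).
by rewrite -/(removable p I) -/(addable p I) nr na.
Qed.

Lemma exists_removable K I :
  K \proper I -> exists2 p, removable p I & p \notin K.
Proof.
move=> /properP[KI [x xI xK]].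
have [|p] := @exists_maximal _ _ (I :\: K) x; first by rewrite inE xK.
rewrite inE => /andP[pK pI] pmax; exists p => //.
apply/removableP; split=> // q qI pq; apply: (pmax _ _ pq).
by rewrite inE qI andbT; apply: contra pK => /ideal_le; apply.
Qed.

Lemma ideal_coveredP K I :
  reflect (exists2 p, removable p I & K = toggle p I) (ideal_covered K I).
Proof.
apply: (iffP andP) => [[KI no_between]|[p rp ->]].
  have [p rp pK] := exists_removable KI; exists p => //.
  have K_toggle : K \subset toggle p I.
    by rewrite ideal_set_toggle rp subsetD1 proper_sub.
  apply/val_inj/eqP; rewrite eqEsubset K_toggle; apply: contraR no_between => nK.
  by apply/existsP; exists (toggle p I); rewrite properE K_toggle nK toggle_proper.
rewrite toggle_proper rp; split=> //.
apply/existsP => -[L /andP[/proper_card + /proper_card]].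
by have /andP[pI _] := rp; rewrite ideal_set_toggle rp [#|I|](cardsD1 p) pI; lia.
Qed.

Lemma toggle_removable_inj I :
  {in [set p | removable p I] &, injective (toggle^~ I)}.
Proof.
move=> p q; rewrite !inE => rp rq /(congr1 (fun K : 'J(P) => p \in K)).
rewrite !ideal_set_toggle rp rq setD11 !inE.
by have /andP[-> _] := rp; rewrite andbT => /esym/negbFE/eqP.
Qed.

Lemma ddegE I : ddeg I = #|[set p | removable p I]|.
Proof.
rewrite -(card_in_imset (@toggle_removable_inj I)) /ddeg; congr #|pred_of_set _|.
apply/setP => K; rewrite inE; apply/ideal_coveredP/imsetP => -[p rp ->].
  by exists p; rewrite ?inE.
by exists p => //; rewrite inE in rp.
Qed.

End Toggles.

Section Criterion.
Context {R : realType} {d : Order.disp_t} {P : finPOrderType d}.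
Local Open Scope ring_scope.

Lemma toggleabilityE (p : P) (I : 'J(P)) :
  toggleability p I = (addable p I)%:R - (removable p I)%:R :> R.
Proof.
by rewrite /toggleability /toggle_plus proper_toggle /toggle_minus toggle_proper.
Qed.

Lemma natr_ddeg (I : 'J(P)) : (ddeg I)%:R = \sum_p (removable p I)%:R :> R.
Proof.
rewrite ddegE -sum1_card natr_sum big_mkcond.
by apply: eq_bigr => p _; rewrite inE; case: ifP.
Qed.

Lemma uniform_is_distribution : is_distribution (@uniform R d P).
Proof.
have ideal0 : is_ideal (set0 : {set P}) by apply/is_idealP => p q; rewrite inE.
split=> [I|]; first by rewrite invr_ge0 ler0n.
rewrite sumr_const -[LHS]mulr_natl mulfV // pnatr_eq0 -lt0n.
by apply/card_gt0P; exists (Ideal ideal0).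
Qed.

Lemma uniform_toggle_symmetric : toggle_symmetric (@uniform R d P).
Proof.
move=> p; rewrite /expectation -mulr_sumr.
suff sum_opp : \sum_I toggleability p I = - (\sum_I toggleability p I) :> R.
  by rewrite (_ : \sum_I _ = 0) ?mulr0 //; lra.
rewrite {1}(reindex_inj (inv_inj (toggleK p))) -sumrN.
apply: eq_bigr => I _; rewrite /toggleability /toggle_plus /toggle_minus.
by rewrite toggleK opprB.
Qed.

Lemma expectation_toggle_symmetric (mu f : 'J(P) -> R) b c :
    is_distribution mu -> toggle_symmetric mu ->
    (forall I, f I = b + \sum_p c p * toggleability p I) ->
  expectation mu f = b.
Proof.
move=> [_ mu1] mu_sym fE; rewrite /expectation.
under eq_bigr => I _ do rewrite fE mulrDr mulr_sumr.
rewrite big_split /= -mulr_suml mu1 mul1r exchange_big big1 ?addr0 //= => p _.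
under eq_bigr => I _ do rewrite mulrCA.
by rewrite -mulr_sumr [X in _ * X]mu_sym mulr0.
Qed.

Lemma tCDE_of_toggleability a b (c : P -> R) : a != 0 ->
    (forall I : 'J(P), a * (ddeg I)%:R = b + \sum_p c p * toggleability p I) ->
  tCDE R P.
Proof.
move=> a0 ddeg_lin mu mu_distr mu_sym.
have ddeg_affine (I : 'J(P)) :
    (ddeg I)%:R = a^-1 * b + \sum_p a^-1 * c p * toggleability p I.
  under eq_bigr => p _ do rewrite -mulrA.
  by rewrite -mulr_sumr -mulrDr -ddeg_lin mulKf.
rewrite (expectation_toggle_symmetric mu_distr mu_sym ddeg_affine); apply/esym.
apply: expectation_toggle_symmetric ddeg_affine.
  exact: uniform_is_distribution.
exact: uniform_toggle_symmetric.
Qed.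

End Criterion.

(** * Quotients *)

(* A map satisfying these hypotheses is, for example, the quotient of a poset by a
   group of automorphisms. *)
Section Fold.
Context {d d' : Order.disp_t} {P : finPOrderType d} {Q : finPOrderType d'}.
Variable phi : P -> Q.
Hypothesis phi_lt : {homo phi : p q / (p < q)%O}.
Hypothesis lift_le :
  forall p y, (y <= phi p)%O -> exists2 q, (q <= p)%O & phi q = y.
Hypothesis lift_ge :
  forall p y, (phi p <= y)%O -> exists2 q, (p <= q)%O & phi q = y.
Implicit Types (I : 'J(Q)) (p : P).

Lemma is_ideal_preim I : is_ideal (phi @^-1: I).
Proof.
apply/is_idealP => p q; rewrite !inE => pI qp.
exact: ideal_le pI (ltW_homo phi_lt qp).
Qed.

Definition preim_ideal I : 'J(P) := Ideal (is_ideal_preim I).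

Lemma in_preim_ideal p I : (p \in preim_ideal I) = (phi p \in I).
Proof. by rewrite inE. Qed.

Lemma removable_preim p I : removable p (preim_ideal I) = removable (phi p) I.
Proof.
apply/removableP/removableP; rewrite in_preim_ideal => -[pI pmax]; split=> //.
  move=> y yI /lift_ge[q pq qy]; rewrite -qy in yI *.
  by rewrite (pmax q) // in_preim_ideal.
move=> q; rewrite in_preim_ideal => qI; rewrite le_eqVlt => /predU1P[//|/phi_lt pq].
by move: (pq); rewrite (pmax _ qI (ltW pq)) ltxx.
Qed.

Lemma addable_preim p I : addable p (preim_ideal I) = addable (phi p) I.
Proof.
apply/addableP/addableP; rewrite in_preim_ideal => -[pI pmin]; split=> //.
  move=> y /lift_le[q qp <-] nqp; rewrite -in_preim_ideal.
  by apply: pmin => //; apply: contraNneq nqp => ->.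
move=> q qp nqp; have /phi_lt qp_lt : (q < p)%O by rewrite lt_neqAle nqp.
by rewrite in_preim_ideal pmin ?ltW // lt_eqF.
Qed.

End Fold.

(** * Type A *)

Section TypeACoordinates.
Variable n : nat.
Implicit Types (p q : PhiA n) (I : 'J(PhiA n)).

Definition rowA p : nat := (val p).1.
Definition colA p : nat := (val p).2.

Lemma leAE p q : (p <= q)%O = (rowA q <= rowA p) && (colA p <= colA q).
Proof. by []. Qed.

Lemma rootA_bounds p : [&& 1 <= rowA p, rowA p <= colA p & colA p <= n].
Proof. by have := valP p; have := ltn_ord (val p).2; rewrite /rowA /colA; lia. Qed.

Lemma rootA_inj p q : rowA p = rowA q -> colA p = colA q -> p = q.
Proof. by move=> row col; apply/eqP; rewrite eq_le !leAE row col !leqnn. Qed.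

Lemma rootA_subproof i j : [&& 1 <= i, i <= j & j <= n] ->
  1 <= (inord i : 'I_n.+1) <= (inord j : 'I_n.+1).
Proof. by move=> ij; rewrite !inordK; lia. Qed.

Definition rootA i j (ij : [&& 1 <= i, i <= j & j <= n]) : PhiA n :=
  exist _ (inord i, inord j) (rootA_subproof ij).

Lemma rowA_rootA i j ij : rowA (@rootA i j ij) = i.
Proof. by rewrite /rowA /= inordK; lia. Qed.

Lemma colA_rootA i j ij : colA (@rootA i j ij) = j.
Proof. by rewrite /colA /= inordK; lia. Qed.

Lemma eq_rootA p i j ij : (p == @rootA i j ij) = (rowA p == i) && (colA p == j).
Proof.
apply/eqP/andP => [->|[/eqP row /eqP col]]; first by rewrite rowA_rootA colA_rootA.
by apply: rootA_inj; rewrite ?rowA_rootA ?colA_rootA.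
Qed.

(* Membership in [I], extended to all positions of the grid [0, n + 1]^2 so that
   the first row of a column of the triangle is always defined. *)
Definition grid_in I i j : bool :=
  [&& 0 < i, j <= n & [forall q, (i <= rowA q) && (colA q <= j) ==> (q \in I)]].

Lemma grid_inP I i j :
  reflect [/\ 0 < i, j <= n &
              forall q, i <= rowA q -> colA q <= j -> q \in I] (grid_in I i j).
Proof.
apply: (iffP and3P) => -[i0 jn below]; split=> //.
  by move=> q iq qj; have /implyP := forallP below q; rewrite iq qj; apply.
by apply/forallP => q; apply/implyP => /andP[]; apply: below.
Qed.

Lemma grid_in_mono I i i' j j' :
  i <= i' -> j' <= j -> grid_in I i j -> grid_in I i' j'.
Proof.
move=> ii jj /grid_inP[i0 jn below]; apply/grid_inP; split; [lia..|].
by move=> q iq qj; apply: below; lia.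
Qed.

Lemma grid_in_root I p : grid_in I (rowA p) (colA p) = (p \in I).
Proof.
have /and3P[row0 _ coln] := rootA_bounds p.
apply/grid_inP/idP => [[_ _]|pI]; first exact.
by split=> // q row col; apply: ideal_le pI _; rewrite leAE row.
Qed.

Definition first_row I j : nat := find (grid_in I ^~ j) (iota 0 n.+2).

Lemma first_row_le I i j : i <= n.+1 -> (first_row I j <= i) = grid_in I i j.
Proof.
move=> i_le; apply/idP/idP => [find_le|]; last first.
  by apply: contraTT; rewrite -ltnNge => /(before_find 0); rewrite nth_iota // => ->.
have find_lt : first_row I j < n.+2 by rewrite ltnS (leq_trans find_le).
apply: grid_in_mono find_le (leqnn j) _.
have := find_lt; rewrite -[n.+2](size_iota 0) -has_find => /(nth_find 0).
by rewrite nth_iota.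
Qed.

Lemma in_first_row I p : (p \in I) = (first_row I (colA p) <= rowA p).
Proof.
by rewrite first_row_le ?grid_in_root //; have := rootA_bounds p; lia.
Qed.

Lemma first_row_bounds I j : j <= n -> 0 < first_row I j <= j.+1.
Proof.
move=> jn; rewrite ltnNge !first_row_le //=.
by apply/grid_inP; split=> // q; have := rootA_bounds q; lia.
Qed.

Lemma first_row0 I : first_row I 0 = 1.
Proof. by have := @first_row_bounds I 0 (leq0n n); lia. Qed.

Lemma first_row_last I : n.+1 < first_row I n.+1.
Proof. by rewrite ltnNge first_row_le // /grid_in ltnn andbF. Qed.

Lemma first_row_mono I j k : j <= k -> first_row I j <= first_row I k.
Proof.
move=> jk; have [k_le|k_gt] := leqP (first_row I k) n.+1; last first.
  by rewrite (leq_trans _ k_gt) // -(size_iota 0 n.+2) find_size.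
by rewrite first_row_le // (grid_in_mono (leqnn _) jk) // -first_row_le.
Qed.

Lemma in_rootA I i j ij : (@rootA i j ij \in I) = (first_row I j <= i).
Proof. by rewrite in_first_row rowA_rootA colA_rootA. Qed.

Lemma removableA I p :
  removable p I =
  (first_row I (colA p) == rowA p) && (rowA p < first_row I (colA p).+1).
Proof.
have /and3P[row1 rowcol coln] := rootA_bounds p.
apply/removableP/andP => [[pI pmax]|[/eqP first_row_p lt_next]].
- have only_max i j : [&& 1 <= i, i <= j & j <= n] -> first_row I j <= i ->
      i <= rowA p -> colA p <= j -> (rowA p == i) && (colA p == j).
    move=> ij iI ip pj; rewrite -(eq_rootA p ij) eq_sym; apply/eqP/pmax.
      by rewrite in_rootA.
    by rewrite leAE rowA_rootA colA_rootA ip.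
  have first_bounds := first_row_bounds I coln; rewrite in_first_row in pI.
  split; first by have := only_max (rowA p).-1 (colA p); lia.
  have [->|neq_coln] := eqVneq (colA p) n; first by have := first_row_last I; lia.
  by have := only_max (rowA p) (colA p).+1; lia.
- rewrite in_first_row first_row_p; split=> // q; rewrite in_first_row leAE.
  move=> qI /andP[row_le]; rewrite leq_eqVlt => /predU1P[col_eq|col_lt].
    by apply: rootA_inj => //; move: qI; rewrite -col_eq first_row_p; lia.
  by have := @first_row_mono I _ _ col_lt; lia.
Qed.

Lemma addableA I p :
  addable p I =
  (first_row I (colA p) == (rowA p).+1) && (first_row I (colA p).-1 <= rowA p).
Proof.
have /and3P[row1 rowcol coln] := rootA_bounds p.
apply/addableP/andP; rewrite in_first_row -ltnNge => -[].
- move=> lt_first pmin.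
  have first_row_below i j : [&& 1 <= i, i <= j & j <= n] ->
      rowA p <= i -> j <= colA p -> (rowA p != i) || (colA p != j) ->
      first_row I j <= i.
    move=> ij pi jp neq; rewrite -(in_rootA I ij); apply: pmin.
      by rewrite leAE rowA_rootA colA_rootA pi.
    by rewrite eq_sym eq_rootA negb_and.
  have [row_col|row_col] := eqVneq (rowA p) (colA p).
    have := first_row_bounds I coln; have := @first_row_bounds I (colA p).-1.
    by lia.
  by have := first_row_below (rowA p).+1 (colA p);
     have := first_row_below (rowA p) (colA p).-1; lia.
- move=> /eqP first_row_p prev_le; rewrite first_row_p; split=> // q.
  rewrite in_first_row leAE => /andP[row_le].
  rewrite leq_eqVlt => /predU1P[col_eq|col_lt] q_neq.
    rewrite col_eq first_row_p ltn_neqAle row_le andbT.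
    by apply: contra_neq q_neq => row_eq; apply: rootA_inj.
  by have := @first_row_mono I (colA q) (colA p).-1; lia.
Qed.

End TypeACoordinates.

Section TypeASums.
Variables (n : nat) (R : realType).
Implicit Types (p : PhiA n) (I : 'J(PhiA n)).
Local Open Scope ring_scope.

Lemma sum_column_at_row (S : pzSemiRingType) (F : nat -> S) i (j : 'I_n.+1) :
  \sum_(p : PhiA n | (val p).2 == j) F (rowA p) * (i == rowA p)%:R =
  F i * (1 <= i <= j)%N%:R.
Proof.
have [ij|ij] := boolP (1 <= i <= j)%N; last first.
  rewrite mulr0 big1 // => p /eqP p_col.
  case: eqP => [i_row|_]; last by rewrite mulr0.
  by have := rootA_bounds p; rewrite i_row /colA p_col in ij *; lia.
have ijn : [&& (1 <= i)%N, (i <= j)%N & (j <= n)%N] by have := ltn_ord j; lia.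
rewrite (bigD1 (rootA ijn)) /=; last by rewrite -val_eqE /= inordK.
rewrite rowA_rootA eqxx big1 ?addr0 // => p /andP[p_col].
by rewrite eq_rootA /colA (eqP p_col) eqxx andbT eq_sym => /negPf ->; rewrite mulr0.
Qed.

Lemma sum_removable_column I (j : 'I_n.+1) :
  \sum_(p : PhiA n | (val p).2 == j)
     (j%:R + 1 - (rowA p)%:R) * (removable p I)%:R =
  (j%:R + 1 - (first_row I j)%:R) * (first_row I j < first_row I j.+1)%N%:R :> R.
Proof.
pose F (i : nat) : R := (j%:R + 1 - i%:R) * (i < first_row I j.+1)%N%:R.
transitivity (\sum_(p : PhiA n | (val p).2 == j)
                F (rowA p) * (first_row I j == rowA p)%:R).
  apply: eq_bigr => p /eqP p_col.
  by rewrite removableA /F -p_col -mulrA -natrM mulnb andbC.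
rewrite sum_column_at_row /F.
have /andP[-> first_le] := first_row_bounds I (ltn_ord j).
case: (leqP (first_row I j) j) => [_|lt_first]; first by rewrite mulr1.
have -> : first_row I j = j.+1 by lia.
by rewrite -natr1; ring.
Qed.

Lemma sum_addable_column I (j : 'I_n.+1) :
  \sum_(p : PhiA n | (val p).2 == j)
     (j%:R - 1 - (rowA p)%:R) * (addable p I)%:R =
  (j%:R - (first_row I j)%:R) * (first_row I j.-1 < first_row I j)%N%:R :> R.
Proof.
have := first_row_bounds I (ltn_ord j).
case first_j : (first_row I j) => [//|i] /= i_le.
pose F (i : nat) : R := (j%:R - 1 - i%:R) * (first_row I j.-1 <= i)%N%:R.
transitivity (\sum_(p : PhiA n | (val p).2 == j) F (rowA p) * (i == rowA p)%:R).
  apply: eq_bigr => p /eqP p_col.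
  by rewrite addableA /F [colA p]/colA p_col first_j eqSS -mulrA -natrM mulnb andbC.
have /andP[first_prev _] : (0 < first_row I j.-1 <= j.-1.+1)%N.
  by apply: first_row_bounds; have := ltn_ord j; lia.
rewrite sum_column_at_row /F ltnS -mulrA -natrM mulnb.
have -> : (first_row I j.-1 <= i)%N && (1 <= i <= j)%N = (first_row I j.-1 <= i)%N.
  by lia.
by rewrite -[i.+1%:R]natr1 opprD addrA addrAC.
Qed.

(* A discrete antiderivative, found by summation by parts, of the weighted corner
   counts of the columns. *)
Definition column_potential I j : nat :=
  if (first_row I j.-1 < first_row I j)%N then j else first_row I j.

Lemma sum_corners_column I (j : 'I_n.+1) :
  \sum_(p : PhiA n | (val p).2 == j)
     ((j%:R + 1 - (rowA p)%:R) * (removable p I)%:R -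
      (j%:R - 1 - (rowA p)%:R) * (addable p I)%:R) =
  (column_potential I j.+1)%:R - (column_potential I j)%:R :> R.
Proof.
rewrite sumrB sum_removable_column sum_addable_column /column_potential /=.
have := first_row_mono I (leqnSn j); rewrite leq_eqVlt => /predU1P[<-|->].
  by rewrite ltnn; case: ltnP => _ /=; ring.
by rewrite -natr1; case: ltnP => _ /=; ring.
Qed.

Lemma sum_corners I :
  \sum_p (((colA p)%:R + 1 - (rowA p)%:R) * (removable p I)%:R -
          ((colA p)%:R - 1 - (rowA p)%:R) * (addable p I)%:R) = n%:R :> R.
Proof.
have potential0 : column_potential I 0 = 1%N.
  by rewrite /column_potential ltnn first_row0.
have potential_last : column_potential I n.+1 = n.+1.
  rewrite /column_potential; case: ltnP => //=.
  by have := first_row_last I; have := first_row_bounds I (leqnn n); lia.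
transitivity (\sum_(0 <= j < n.+1)
    ((column_potential I j.+1)%:R - (column_potential I j)%:R) : R); last first.
  by rewrite telescope_sumr // potential0 potential_last -natr1 addrK.
rewrite big_mkord (partition_big (fun p : PhiA n => (val p).2) xpredT) //=.
apply: eq_bigr => j _; rewrite -sum_corners_column.
by apply: eq_bigr => p /eqP p_col; rewrite /colA p_col.
Qed.

Lemma ddegA I :
  2 * (ddeg I)%:R =
  n%:R + \sum_p ((colA p)%:R - (rowA p)%:R - 1) * toggleability p I :> R.
Proof.
rewrite natr_ddeg mulr_sumr -(sum_corners I) -big_split; apply: eq_bigr => p _ /=.
by rewrite toggleabilityE; ring.
Qed.

Lemma tCDE_A : tCDE R (PhiA n).
Proof. by apply: tCDE_of_toggleability ddegA; rewrite pnatr_eq0. Qed.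

End TypeASums.

(** * Type B *)

Section TypeBCoordinates.
Variable n : nat.
Implicit Types q : PhiB n.

Definition rowB q : nat := (val q).1.
Definition colB q : nat := (val q).2.

Lemma leBE q q' : (q <= q')%O = (rowB q' <= rowB q) && (colB q' <= colB q).
Proof. by []. Qed.

Lemma rootB_bounds q : [&& 1 <= rowB q, rowB q <= colB q & rowB q + colB q <= 2 * n].
Proof. by have := valP q; have := ltn_ord (val q).1; rewrite /rowB /colB; lia. Qed.

Lemma rootB_inj q q' : rowB q = rowB q' -> colB q = colB q' -> q = q'.
Proof. by move=> row col; apply/eqP; rewrite eq_le !leBE row col !leqnn. Qed.

Lemma rootB_subproof i j : [&& 1 <= i, i <= j & i + j <= 2 * n] ->
  let i' : 'I_n.+1 := inord i in let j' : 'I_(2 * n).+1 := inord j in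
  (1 <= i') && (i' <= j' <= 2 * n - i').
Proof. by move=> ij; rewrite /= !inordK; lia. Qed.

Definition rootB i j (ij : [&& 1 <= i, i <= j & i + j <= 2 * n]) : PhiB n :=
  exist _ (inord i, inord j) (rootB_subproof ij).

Lemma rowB_rootB i j ij : rowB (@rootB i j ij) = i.
Proof. by rewrite /rowB /= inordK; lia. Qed.

Lemma colB_rootB i j ij : colB (@rootB i j ij) = j.
Proof. by rewrite /colB /= inordK; lia. Qed.

Lemma rootB_eq q i j ij : (@rootB i j ij == q) = (i == rowB q) && (j == colB q).
Proof.
apply/eqP/andP => [<-|[/eqP row /eqP col]]; first by rewrite rowB_rootB colB_rootB.
by apply: rootB_inj; rewrite ?rowB_rootB ?colB_rootB.
Qed.

Definition on_axis q : bool := rowB q == colB q.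

End TypeBCoordinates.

Section TypeBFold.
Variable n : nat.
Implicit Types (p : PhiA (2 * n).-1) (q : PhiB n).

Lemma foldAB_subproof p (i := rowA p) (j := 2 * n - colA p) :
  [&& 1 <= minn i j, minn i j <= maxn i j & minn i j + maxn i j <= 2 * n].
Proof. by have := rootA_bounds p; rewrite /i /j; lia. Qed.

(* The quotient by the reflection (i, j) |-> (2n - j, 2n - i) of type A_(2n-1). *)
Definition foldAB p : PhiB n := rootB (foldAB_subproof p).

Lemma rowB_foldAB p : rowB (foldAB p) = minn (rowA p) (2 * n - colA p).
Proof. exact: rowB_rootB. Qed.

Lemma colB_foldAB p : colB (foldAB p) = maxn (rowA p) (2 * n - colA p).
Proof. exact: colB_rootB. Qed.

Lemma unfold_lower_subproof q :
  [&& 1 <= rowB q, rowB q <= 2 * n - colB q & 2 * n - colB q <= (2 * n).-1].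
Proof. by have := rootB_bounds q; lia. Qed.

Lemma unfold_upper_subproof q :
  [&& 1 <= colB q, colB q <= 2 * n - rowB q & 2 * n - rowB q <= (2 * n).-1].
Proof. by have := rootB_bounds q; lia. Qed.

Definition unfold_lower q : PhiA (2 * n).-1 := rootA (unfold_lower_subproof q).
Definition unfold_upper q : PhiA (2 * n).-1 := rootA (unfold_upper_subproof q).

Lemma foldAB_eq p q :
  (foldAB p == q) = (p == unfold_lower q) || (p == unfold_upper q).
Proof.
by have := rootA_bounds p; have := rootB_bounds q; rewrite rootB_eq !eq_rootA; lia.
Qed.

(* The preimage of [q] on the same side of the axis as [p]. *)
Definition unfold_near p q : PhiA (2 * n).-1 :=
  if rowA p <= 2 * n - colA p then unfold_lower q else unfold_upper q.

Lemma unfold_nearK p q : foldAB (unfold_near p q) = q.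
Proof.
by apply/eqP; rewrite /unfold_near foldAB_eq; case: ifP; rewrite eqxx ?orbT.
Qed.

Lemma le_unfold_near p q :
  ((unfold_near p q <= p)%O = (q <= foldAB p)%O) *
  ((p <= unfold_near p q)%O = (foldAB p <= q)%O).
Proof.
have p_bounds := rootA_bounds p; have q_bounds := rootB_bounds q.
rewrite /unfold_near !leAE !leBE rowB_foldAB colB_foldAB.
by split; case: ifP; rewrite rowA_rootA colA_rootA; lia.
Qed.

Lemma foldAB_lt : {homo foldAB : p p' / (p < p')%O}.
Proof.
move=> p p'; rewrite !lt_neqAle leAE leBE !rowB_foldAB !colB_foldAB.
move=> /andP[neq le_pp'].
have p_bounds := rootA_bounds p; have p'_bounds := rootA_bounds p'.
apply/andP; split; last by lia.
apply: contra_neq neq => /eqP; rewrite rootB_eq rowB_foldAB colB_foldAB => eq_pp'.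
by apply: rootA_inj; lia.
Qed.

Lemma foldAB_lift_le p q :
  (q <= foldAB p)%O -> exists2 p', (p' <= p)%O & foldAB p' = q.
Proof. by exists (unfold_near p q); rewrite ?le_unfold_near ?unfold_nearK. Qed.

Lemma foldAB_lift_ge p q :
  (foldAB p <= q)%O -> exists2 p', (p <= p')%O & foldAB p' = q.
Proof. by exists (unfold_near p q); rewrite ?le_unfold_near ?unfold_nearK. Qed.

Lemma eq_unfold q : (unfold_lower q == unfold_upper q) = on_axis q.
Proof.
by have := rootB_bounds q; rewrite eq_rootA rowA_rootA colA_rootA /on_axis; lia.
Qed.

Lemma sum_foldAB (V : zmodType) (F : PhiB n -> V) :
  (\sum_p F (foldAB p) = \sum_q F q *+ 2 - \sum_(q | on_axis q) F q)%R.
Proof.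
rewrite (partition_big foldAB xpredT) //= [X in (_ - X)%R]big_mkcond -sumrB.
apply: eq_bigr => q _.
rewrite (eq_bigr (fun=> F q)) => [|p /eqP -> //]; rewrite sumr_const.
have -> : #|[pred p | foldAB p == q]| = (~~ on_axis q).+1.
  rewrite -eq_unfold -cards2; apply: eq_card => p.
  by rewrite !inE foldAB_eq.
by case: (on_axis q); rewrite ?mulr1n ?subr0 // mulr2n addrK.
Qed.

End TypeBFold.

Section TypeBAxis.
Variable n : nat.
Implicit Types (q : PhiB n) (I : 'J(PhiB n)).

(* Whether the position (i, i + 1), next to the axis, belongs to [I], extended to
   all [i <= n]. *)
Definition next_to_axis_in I i : bool :=
  (0 < i) && [forall q, (i <= rowB q) && (i < colB q) ==> (q \in I)].

Lemma next_to_axis_inP I i :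
  reflect (0 < i /\ forall q, i <= rowB q -> i < colB q -> q \in I)
          (next_to_axis_in I i).
Proof.
apply: (iffP andP) => -[i0 below]; split=> //.
  by move=> q iq qj; have /implyP := forallP below q; rewrite iq qj; apply.
by apply/forallP => q; apply/implyP => /andP[]; apply: below.
Qed.

Lemma removable_on_axis I q : on_axis q ->
  removable q I = (q \in I) && ~~ next_to_axis_in I (rowB q).-1.
Proof.
move=> /eqP axis_q; have q_bounds := rootB_bounds q.
apply/removableP/andP => -[qI qmax]; split=> //.
  apply/next_to_axis_inP => -[row_gt1 below].
  have ij : [&& 1 <= (rowB q).-1, (rowB q).-1 <= rowB q &
                (rowB q).-1 + rowB q <= 2 * n] by lia.
  suff /eqP : rootB ij = q by rewrite rootB_eq; lia.
  by apply: qmax; [apply: below|rewrite leBE]; rewrite ?rowB_rootB ?colB_rootB; lia.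
move=> r rI; rewrite leBE => qr; have r_bounds := rootB_bounds r.
have [row_lt|row_ge] := ltnP (rowB r) (rowB q); last by apply: rootB_inj; lia.
case/next_to_axis_inP: qmax; split; first by lia.
by move=> s row_s col_s; apply: ideal_le rI _; rewrite leBE; lia.
Qed.

Lemma addable_on_axis I q : on_axis q ->
  addable q I = (q \notin I) && next_to_axis_in I (rowB q).
Proof.
move=> /eqP axis_q; have q_bounds := rootB_bounds q.
apply/addableP/andP => -[qI qmin]; split=> //.
  apply/next_to_axis_inP; split=> [|r row_r col_r]; first by lia.
  apply: qmin; first by rewrite leBE; lia.
  by apply: contraTneq col_r => ->; lia.
move=> r; rewrite leBE => rq neq; have r_bounds := rootB_bounds r.
case/next_to_axis_inP: qmin => _; apply; first by lia.
rewrite ltnNge; apply: contra_neqN neq => col_le; apply: rootB_inj; lia.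
Qed.

Local Open Scope ring_scope.

Lemma sum_on_axis (V : nmodType) (F : nat -> V) :
  \sum_(q : PhiB n | on_axis q) F (rowB q) = \sum_(i < n) F i.+1.
Proof.
have axis_subproof (i : 'I_n) :
    [&& 1 <= i.+1, i.+1 <= i.+1 & i.+1 + i.+1 <= 2 * n]%N.
  by have := ltn_ord i; lia.
have row_subproof q : ((rowB q).-1 < n)%N by have := rootB_bounds q; lia.
rewrite (reindex_onto (fun i => rootB (axis_subproof i))
                      (fun q => Ordinal (row_subproof q))) => [|q axis_q].
  apply: eq_big => [i|i _]; last by rewrite rowB_rootB.
  by rewrite /on_axis -val_eqE /= rowB_rootB colB_rootB !eqxx.
by apply/eqP; have := rootB_bounds q; rewrite rootB_eq -(eqP axis_q) /=; lia.
Qed.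

Lemma axis_corners (R : realType) I q : on_axis q ->
  (removable q I)%:R + (addable q I)%:R =
  (next_to_axis_in I (rowB q))%:R - (next_to_axis_in I (rowB q).-1)%:R :> R.
Proof.
move=> axis_q; rewrite removable_on_axis // addable_on_axis //.
have q_bounds := rootB_bounds q; move/eqP: axis_q => axis_q.
have [qI|qI] /= := boolP (q \in I).
  suff -> : next_to_axis_in I (rowB q) by case: next_to_axis_in => /=; ring.
  apply/next_to_axis_inP; split; first by lia.
  by move=> r row_r col_r; apply: ideal_le qI _; rewrite leBE; lia.
suff /negPf -> : ~~ next_to_axis_in I (rowB q).-1 by rewrite add0r subr0.
by apply: contra qI => /next_to_axis_inP[_]; apply; lia.
Qed.

Lemma sum_axis_corners (R : realType) I : (0 < n)%N ->
  \sum_(q | on_axis q) ((removable q I)%:R + (addable q I)%:R) = 1 :> R.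
Proof.
move=> n0; pose F i : R := (next_to_axis_in I i)%:R - (next_to_axis_in I i.-1)%:R.
rewrite (eq_bigr (F \o @rowB n)) => [|q]; last exact: axis_corners.
rewrite (sum_on_axis F) -(big_mkord xpredT (F \o S)).
rewrite (telescope_sumr (fun i => (next_to_axis_in I i)%:R)) //.
have -> : next_to_axis_in I n.
  by apply/next_to_axis_inP; split=> // q; have := rootB_bounds q; lia.
by rewrite /next_to_axis_in subr0.
Qed.

End TypeBAxis.

Section TypeBDegree.
Variables (n : nat) (R : realType).
Implicit Types (q : PhiB n) (I : 'J(PhiB n)).
Local Open Scope ring_scope.

Definition coefB q : R := (2 * n)%:R - (rowB q)%:R - (colB q)%:R - 1.

Lemma coefB_foldAB (p : PhiA (2 * n).-1) :
  coefB (foldAB p) = (colA p)%:R - (rowA p)%:R - 1.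
Proof.
have p_bounds := rootA_bounds p; rewrite /coefB rowB_foldAB colB_foldAB.
set x := minn _ _; set y := maxn _ _.
have sum_xy : x%:R + y%:R = (rowA p)%:R + ((2 * n)%:R - (colA p)%:R) :> R.
  by rewrite -natrB; [rewrite -!natrD addn_min_max|lia].
by lra.
Qed.

Lemma sum_removable_foldAB I :
  2 * \sum_(p : PhiA (2 * n).-1) (removable (foldAB p) I)%:R =
  (2 * n).-1%:R +
    \sum_(p : PhiA (2 * n).-1) coefB (foldAB p) * toggleability (foldAB p) I.
Proof.
pose I' := preim_ideal (@foldAB_lt n) I.
have removable_fold p : removable p I' = removable (foldAB p) I.
  exact/removable_preim/foldAB_lift_ge.
have addable_fold p : addable p I' = addable (foldAB p) I.
  exact/addable_preim/foldAB_lift_le.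
under eq_bigr => p _ do rewrite -removable_fold.
rewrite -natr_ddeg ddegA; congr (_ + _); apply: eq_bigr => p _.
by rewrite coefB_foldAB !toggleabilityE removable_fold addable_fold.
Qed.

Lemma ddegB I : (0 < n)%N ->
  4 * (ddeg I)%:R = (2 * n)%:R +
    \sum_q (2 * coefB q - (on_axis q)%:R * (coefB q + 1)) * toggleability q I :> R.
Proof.
move=> n0; have := sum_removable_foldAB I; have := @sum_axis_corners n R I n0.
rewrite (sum_foldAB (fun q => (removable q I)%:R)).
rewrite (sum_foldAB (fun q => coefB q * toggleability q I)) natr_ddeg.
have -> : \sum_(q | on_axis q) ((removable q I)%:R + (addable q I)%:R) =
    2 * \sum_(q | on_axis q) (removable q I)%:R +
    \sum_(q | on_axis q) toggleability q I :> R.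
  rewrite mulr_sumr -big_split; apply: eq_bigr => q _ /=.
  by rewrite toggleabilityE; ring.
have -> : \sum_q (2 * coefB q - (on_axis q)%:R * (coefB q + 1)) * toggleability q I =
    \sum_q (coefB q * toggleability q I) *+ 2 -
    \sum_(q | on_axis q) coefB q * toggleability q I -
    \sum_(q | on_axis q) toggleability q I :> R.
  rewrite [X in _ - X - _]big_mkcond [X in _ - _ - X]big_mkcond -!sumrB.
  by apply: eq_bigr => q _; case: on_axis => /=; rewrite mulr2n; ring.
have -> : (2 * n)%:R = (2 * n).-1%:R + 1 :> R by rewrite natr1 prednK // muln_gt0.
rewrite [X in X - _](sumrMnl).
by lra.
Qed.

Lemma tCDE_B : (0 < n)%N -> tCDE R (PhiB n).
Proof.
move=> n0; apply: tCDE_of_toggleability (fun I => ddegB I n0).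
by rewrite pnatr_eq0.
Qed.

End TypeBDegree.

(** * Posets generated by a cover relation *)

Section CoverRelation.
Context {d : Order.disp_t} {P : finPOrderType d}.
Variable cov : rel P.
Hypothesis cov_irr : irreflexive cov.
Hypothesis le_connect : forall p q : P, (p <= q)%O = connect cov p q.
Implicit Types (p q : P) (I : 'J(P)).

Lemma cov_le p q : cov p q -> (p <= q)%O.
Proof. by rewrite le_connect; apply: connect1. Qed.

Lemma cov_neq p q : cov p q -> p != q.
Proof. by apply: contraTneq => ->; rewrite cov_irr. Qed.

Lemma lt_first_cov p q : (p < q)%O -> exists2 r, cov p r & (r <= q)%O.
Proof.
rewrite lt_neqAle le_connect => /andP[neq_pq /connectP[[|r s] /= + q_last]].
  by rewrite q_last eqxx in neq_pq.
move=> /andP[pr r_path]; exists r => //.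
by rewrite le_connect; apply/connectP; exists s.
Qed.

Lemma lt_last_cov p q : (p < q)%O -> exists2 r, cov r q & (p <= r)%O.
Proof.
rewrite lt_neqAle le_connect => /andP[neq_pq /connectP[s]].
case/lastP: s => [|s r] /= + q_last; first by rewrite q_last eqxx in neq_pq.
rewrite q_last last_rcons rcons_path => /andP[s_path sr]; exists (last p s) => //.
by rewrite le_connect; apply/connectP; exists s.
Qed.

Lemma removable_covP p I :
  reflect (p \in I /\ forall q, cov p q -> q \notin I) (removable p I).
Proof.
apply: (iffP (removableP p I)) => -[pI pmax]; split=> // q.
  by move=> pq; apply: contraTN (cov_neq pq) => /pmax -> //; rewrite ?eqxx ?cov_le.
move=> qI; rewrite le_eqVlt => /predU1P[//|/lt_first_cov[r /pmax rI rq]].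
by case/negP: rI; apply: ideal_le qI rq.
Qed.

Lemma addable_covP p I :
  reflect (p \notin I /\ forall q, cov q p -> q \in I) (addable p I).
Proof.
apply: (iffP (addableP p I)) => -[pI pmin]; split=> // q.
  by move=> qp; apply: pmin; rewrite ?cov_le ?cov_neq.
move=> qp nqp; have /lt_last_cov[r /pmin rI qr] : (q < p)%O by rewrite lt_neqAle nqp.
exact: ideal_le rI qr.
Qed.

End CoverRelation.

(** * Type H_3 *)

(* The statistics below are stated for the truth table [f] of an ideal, [f k]
   telling whether it contains x_k, so that they compute. *)
Definition H3_ideal_table (f : nat -> bool) : bool :=
  all (fun u => f u.2 ==> f u.1) H3_cover_pairs.
Definition H3_removable (f : nat -> bool) (k : nat) : bool :=
  f k && all (fun u => (u.1 == k) ==> ~~ f u.2) H3_cover_pairs.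
Definition H3_addable (f : nat -> bool) (k : nat) : bool :=
  ~~ f k && all (fun u => (u.2 == k) ==> f u.1) H3_cover_pairs.

Section TypeH3.
Variable R : realType.
Local Open Scope ring_scope.

(* A solution of the linear system with one equation for each of the 32 ideals. *)
Definition H3_coef : seq R :=
  [:: -1; -1; -1; 0; 0; 1; 0; 2; 0; 1; 2; 4; 3; 2; 1].

Lemma H3_table_identity (f : nat -> bool) : H3_ideal_table f ->
  2 * \sum_(k < 15) (H3_removable f k.+1)%:R =
  3 + \sum_(k < 15) H3_coef`_k *
        ((H3_addable f k.+1)%:R - (H3_removable f k.+1)%:R) :> R.
Proof.
rewrite !big_ord_recl !big_ord0 /H3_ideal_table /H3_removable /H3_addable /=.
case: (f 1); case: (f 2); case: (f 3); case: (f 4) => //=;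
case: (f 5) => //=; case: (f 6) => //=; case: (f 7) => //=;
case: (f 8) => //=; case: (f 9) => //=; case: (f 10) => //=;
case: (f 11) => //=; case: (f 12) => //=; case: (f 13) => //=;
case: (f 14) => //=; case: (f 15) => //= _; ring.
Qed.

Lemma H3_cover_irr : irreflexive H3_cover.
Proof.
move=> x; apply: contraTF isT => xx.
have /allP/(_ _ xx) : all (fun u => u.1 < u.2)%N H3_cover_pairs by [].
by rewrite ltnn.
Qed.

Definition ideal_table (I : 'J(PhiH3)) (k : nat) : bool :=
  (inord k.-1 : PhiH3) \in I.

Lemma ideal_tableE I (p : PhiH3) : ideal_table I (p : 'I_15).+1 = (p \in I).
Proof. by rewrite /ideal_table inord_val. Qed.

Lemma H3_cover_pairsP (b : nat -> nat -> bool) :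
  reflect (forall p q : PhiH3, H3_cover p q -> b (p : 'I_15).+1 (q : 'I_15).+1)
          (all (fun u => b u.1 u.2) H3_cover_pairs).
Proof.
apply: (iffP allP) => [b_all p q /b_all //|b_cov [k l] kl].
have /allP/(_ _ kl) :
  all (fun u => (0 < u.1 <= 15) && (0 < u.2 <= 15))%N H3_cover_pairs by [].
case: k l kl => [|k] [|l] //= kl; rewrite ?andbF // => /andP[k15 l15].
exact: (b_cov (Ordinal k15) (Ordinal l15)).
Qed.

Lemma ideal_table_ideal I : H3_ideal_table (ideal_table I).
Proof.
apply/(H3_cover_pairsP (fun k l => ideal_table I l ==> ideal_table I k)) => p q pq.
rewrite !ideal_tableE; apply/implyP => qI; apply: ideal_le qI _.
exact: connect1.
Qed.

Lemma removable_H3 I (p : PhiH3) :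
  removable p I = H3_removable (ideal_table I) (p : 'I_15).+1.
Proof.
rewrite /H3_removable ideal_tableE.
apply/(removable_covP H3_cover_irr (fun _ _ => erefl))/andP => -[pI pmax];
  split=> //.
  apply/(H3_cover_pairsP (fun k l => (k == _) ==> ~~ ideal_table I l)) => q r qr.
  rewrite ideal_tableE; apply/implyP => /eqP[/val_inj qp].
  by apply: pmax; rewrite -qp.
move/(H3_cover_pairsP (fun k l => (k == _) ==> ~~ ideal_table I l)) in pmax.
by move=> q pq; have := pmax _ _ pq; rewrite eqxx ideal_tableE.
Qed.

Lemma addable_H3 I (p : PhiH3) :
  addable p I = H3_addable (ideal_table I) (p : 'I_15).+1.
Proof.
rewrite /H3_addable ideal_tableE.
apply/(addable_covP H3_cover_irr (fun _ _ => erefl))/andP => -[pI pmin];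
  split=> //.
  apply/(H3_cover_pairsP (fun k l => (l == _) ==> ideal_table I k)) => q r qr.
  rewrite ideal_tableE; apply/implyP => /eqP[/val_inj rp].
  by apply: pmin; rewrite -rp.
move/(H3_cover_pairsP (fun k l => (l == _) ==> ideal_table I k)) in pmin.
by move=> q qp; have := pmin _ _ qp; rewrite eqxx ideal_tableE.
Qed.

Lemma ddeg_H3 (I : 'J(PhiH3)) :
  2 * (ddeg I)%:R = 3 + \sum_(p : PhiH3) H3_coef`_(p : 'I_15) * toggleability p I.
Proof.
rewrite natr_ddeg.
under eq_bigr => p _ do rewrite removable_H3.
under [in RHS]eq_bigr => p _ do rewrite toggleabilityE removable_H3 addable_H3.
exact: H3_table_identity (ideal_table_ideal I).
Qed.

Lemma tCDE_H3 : tCDE R PhiH3.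
Proof. by apply: tCDE_of_toggleability ddeg_H3; rewrite pnatr_eq0. Qed.

End TypeH3.

(** * Type I_2 *)

Section TypeI2.
Variable m : nat.
Implicit Types (I : 'J(PhiI2 m)) (u : bool) (k : 'I_(m - 2)).

Definition meets_chain I : bool := [exists k, inr k \in I].

Lemma meets_chainP I : reflect (exists k, inr k \in I) (meets_chain I).
Proof. exact: existsP. Qed.

Lemma meets_chain_atom I u : meets_chain I -> inl u \in I.
Proof. by move=> /meets_chainP[k kI]; apply: ideal_le kI _. Qed.

Lemma removable_atom I u :
  removable (inl u : PhiI2 m) I = (inl u \in I) && ~~ meets_chain I.
Proof.
apply/removableP/andP => -[uI umax]; split=> //.
  by apply/meets_chainP => -[k kI]; have := umax _ kI isT.
move=> [v|k] qI; last by case/meets_chainP: umax; exists k.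
by move=> /eqP ->.
Qed.

Lemma addable_atom I u : addable (inl u : PhiI2 m) I = (inl u \notin I).
Proof.
by apply/addableP/idP => [[]//|uI]; split=> // -[v|//] /eqP -> /eqP.
Qed.

Lemma sum_removable_chain I :
  \sum_k removable (inr k : PhiI2 m) I = meets_chain I.
Proof.
have [/meets_chainP[k0 k0I]|no_chain] := boolP (meets_chain I); last first.
  rewrite big1 // => k _; apply/eqP; rewrite eqb0; apply: contra no_chain.
  by move=> /andP[kI _]; apply/meets_chainP; exists k.
have [k kI kmax] := @arg_maxnP _ k0 [pred k | inr k \in I] val k0I.
rewrite (bigD1 k) //= big1 => [|l lk].
  suff -> : removable (inr k : PhiI2 m) I by [].
  apply/removableP; split=> // -[u|l] //= lI kl.
  by congr inr; apply/val_inj/eqP; rewrite eqn_leq [val k <= _]kl andbT; apply: kmax.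
apply/eqP; rewrite eqb0; apply/removableP => -[lI lmax].
by have [kl] := lmax _ kI (kmax l lI); rewrite kl eqxx in lk.
Qed.

Local Open Scope ring_scope.

Lemma ddeg_I2 (R : realType) I :
  2 * (ddeg I)%:R =
  2 + \sum_(p : PhiI2 m) (if p is inl _ then -1 else 0) * toggleability p I :> R.
Proof.
rewrite natr_ddeg !big_sumType /= !big_bool /= [\sum_i 0 * _]big1 => [|k _];
  last by rewrite mul0r.
rewrite -natr_sum sum_removable_chain !toggleabilityE !removable_atom !addable_atom.
have := @meets_chain_atom I true; have := @meets_chain_atom I false.
case: (meets_chain I) => [/(_ isT) -> /(_ isT) ->|_ _] /=; first by ring.
by case: (inl true \in I); case: (inl false \in I) => /=; ring.
Qed.

Lemma tCDE_I2 (R : realType) : tCDE R (PhiI2 m).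
Proof. by apply: tCDE_of_toggleability (@ddeg_I2 R); rewrite pnatr_eq0. Qed.

End TypeI2.

Theorem theorem3p8 (R : realType) :
  [/\ forall n : nat, 1 <= n -> tCDE R (PhiA n),
      forall n : nat, 1 <= n -> tCDE R (PhiB n),
      tCDE R PhiH3
    & forall m : nat, 2 <= m -> tCDE R (PhiI2 m)].
Proof.
split=> [n _|n n0||m _].
- exact: tCDE_A.
- exact: tCDE_B.
- exact: tCDE_H3.
- exact: tCDE_I2.
Qed.
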